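(* Let $G$ be a finite simple 2-connected graph different from $K_2$, and let $H=Aux(G)$ be its spanning tree auxiliary graph. Then $H$ is a prime graph under the Cartesian product operation.
   Context: For a finite simple connected graph $G$ on $n$ vertices, the spanning tree auxiliary graph $Aux(G)$ is the graph whose vertices are the spanning trees of $G$, two spanning trees being adjacent if and only if one is obtained from the other by a single unit transformation, i.e. by adding one edge of $G$ not in the tree and deleting a different edge so that the result is again a spanning tree; equivalently, the symmetric difference of their edge sets has exactly two edges (they share exactly $n-2$ of their $n-1$ edges). A graph is 2-connected if it cannot be disconnected by deleting fewer than two vertices (so it is connected, and $K_2$ counts as 2-connected); by convention the one-vertex graph is not regarded as 2-connected, so the 2-connected graphs other than $K_2$ are exactly those obtainable from a cycle by repeatedly adding ears. The Cartesian product $G_1\Box G_2$ of $G_1=(V_1,E_1)$ and $G_2=(V_2,E_2)$ has vertex set $V_1\times V_2$, with $(u_1,u_2)$ adjacent to $(v_1,v_2)$ iff ($u_1=v_1$ and $u_2v_2\in E_2$) or ($u_1v_1\in E_1$ and $u_2=v_2$). The one-vertex graph $K_1$ is the identity for $\Box$. A graph is prime if it has only one nontrivial factor under the Cartesian product, i.e. it is not $K_1$ and in any decomposition $H\cong H_1\Box H_2$ one of $H_1,H_2$ is $K_1$. *)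

(* Defs.v *)
From mathcomp Require Import all_boot.

Set Implicit Arguments.
Unset Strict Implicit.
Unset Printing Implicit Defensive.

Record sgraph := SGraph {
  vertex :> finType;
  adj : rel vertex;
  adj_sym : symmetric adj;
  adj_irrefl : irreflexive adj
}.

Definition isomorphic (G H : sgraph) : Prop :=
  exists f : G -> H, bijective f /\ forall x y, adj (f x) (f y) = adj x y.

Section Complete.
Variable n : nat.
Definition complete_adj : rel 'I_n := fun x y => x != y.
Lemma complete_sym : symmetric complete_adj.
Proof. by move=> x y; rewrite /complete_adj eq_sym. Qed.
Lemma complete_irrefl : irreflexive complete_adj.
Proof. by move=> x; rewrite /complete_adj eqxx. Qed.
Definition complete : sgraph := SGraph complete_sym complete_irrefl.
End Complete.

Section Product.
Variables G1 G2 : sgraph.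
Definition cart_adj : rel (G1 * G2) := fun u v =>
  (u.1 == v.1) && adj u.2 v.2 || adj u.1 v.1 && (u.2 == v.2).
Lemma cart_sym : symmetric cart_adj.
Proof.
move=> u v; rewrite /cart_adj (eq_sym u.1) (eq_sym u.2).
by rewrite (adj_sym u.1) (adj_sym u.2).
Qed.
Lemma cart_irrefl : irreflexive cart_adj.
Proof. by move=> u; rewrite /cart_adj !adj_irrefl andbF. Qed.
Definition cart_prod : sgraph := SGraph cart_sym cart_irrefl.
End Product.

Definition prime_graph (H : sgraph) : Prop :=
  ~ isomorphic H (complete 1) /\
  forall H1 H2 : sgraph, isomorphic H (cart_prod H1 H2) ->
    isomorphic H1 (complete 1) \/ isomorphic H2 (complete 1).

Section Induced.
Variables (G : sgraph) (S : {set G}).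
Definition induced_adj : rel {x : G | x \in S} :=
  fun x y => adj (val x) (val y).
Lemma induced_sym : symmetric induced_adj.
Proof. by move=> x y; apply: adj_sym. Qed.
Lemma induced_irrefl : irreflexive induced_adj.
Proof. by move=> x; apply: adj_irrefl. Qed.
Definition induced : sgraph := SGraph induced_sym induced_irrefl.
End Induced.

Definition connected (G : sgraph) : bool :=
  (0 < #|G|) && [forall x : G, forall y : G, connect (@adj G) x y].

(* The one-vertex graph is excluded and [complete 2] is included. *)
Definition two_connected (G : sgraph) : bool :=
  (1 < #|G|) && [forall S : {set G}, (#|S| < 2) ==> connected (induced (~: S))].

(* The length bound makes the predicate boolean; see [acyclicP]. *)
Definition acyclic (G : sgraph) : bool :=
  [forall k : 'I_#|G|.+1, forall c : k.-tuple G,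
     (2 < k) ==> ~~ ucycleb (@adj G) c].

Lemma acyclicP (G : sgraph) :
  reflect (forall c : seq G, 2 < size c -> ~ ucycle (@adj G) c) (acyclic G).
Proof.
apply: (iffP forallP) => [ac c c_gt2 cyc_c | ac k].
  have c_le : size c < #|G|.+1.
    case/andP: (cyc_c) => _ /card_uniqP <-; exact: max_card.
  have /forallP/(_ (in_tuple c)) := ac (Ordinal c_le).
  by rewrite c_gt2 => /negP.
apply/forallP => c; apply/implyP => k_gt2; apply/negP.
by apply: ac; rewrite size_tuple.
Qed.

Definition tree (G : sgraph) : bool := connected G && acyclic G.

Definition edges (G : sgraph) : {set {set G}} :=
  [set [set p.1; p.2] | p in [set q : G * G | adj q.1 q.2]].

Section Spanning.
Variables (G : sgraph) (F : {set {set G}}).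
(* [x != y] matters only if [F] contains singletons, i.e. non-edges. *)
Definition spanning_adj : rel G := fun x y => (x != y) && ([set x; y] \in F).
Lemma spanning_sym : symmetric spanning_adj.
Proof. by move=> x y; rewrite /spanning_adj eq_sym setUC. Qed.
Lemma spanning_irrefl : irreflexive spanning_adj.
Proof. by move=> x; rewrite /spanning_adj eqxx. Qed.
Definition spanning_subgraph : sgraph := SGraph spanning_sym spanning_irrefl.
Definition spanning_tree : bool := (F \subset edges G) && tree spanning_subgraph.
End Spanning.

Section Aux.
Variable G : sgraph.
Definition aux_adj : rel {F : {set {set G}} | spanning_tree F} := fun F F' =>
  [exists a in edges G :\: val F, exists b in val F,
     val F' == (a |: val F) :\ b].

Lemma aux_adj_swap F F' : aux_adj F F' -> aux_adj F' F.
Proof.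
case/exists_inP => a; rewrite inE => /andP[aF aE] /exists_inP[b bF /eqP defF'].
have ab : a != b by apply: contraNneq aF => ->.
apply/exists_inP; exists b.
  rewrite defF' !inE eqxx /=.
  by case/andP: (valP F) => /subsetP/(_ b bF).
apply/exists_inP; exists a; first by rewrite defF' !inE ab eqxx.
apply/eqP/setP => z; rewrite defF' !inE.
case: (eqVneq z a) => [-> | _] /=; first exact: negbTE.
by case: (eqVneq z b) => [-> | _].
Qed.

Lemma aux_sym : symmetric aux_adj.
Proof. by move=> F F'; apply/idP/idP; apply: aux_adj_swap. Qed.

Lemma aux_irrefl : irreflexive aux_adj.
Proof.
move=> F; apply/negbTE/negP => adjFF.
case/exists_inP: adjFF => a; rewrite inE => /andP[aF _].
case/exists_inP => b bF /eqP defF; move: (aF).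
rewrite defF !inE eqxx /= andbT negbK => /eqP ab.
by rewrite ab bF in aF.
Qed.

Definition Aux : sgraph := SGraph aux_sym aux_irrefl.
End Aux.

(* Main.v *)
Require Import Defs.
From mathcomp Require Import all_boot.

Set Implicit Arguments.
Unset Strict Implicit.
Unset Printing Implicit Defensive.

(** In a Cartesian product, colour each edge by the coordinate that it changes.
    Two edges that span a triangle have the same colour, so if the open
    neighbourhood of a vertex induces a connected graph then all edges at that
    vertex have one colour; whereas in a connected product of two nontrivial
    factors every vertex meets both colours.  Hence a connected graph having
    one vertex with a nonempty connected neighbourhood is prime
    ([prime_of_connected_link]), and it suffices to study [Aux G] around a
    single spanning tree [T].

    The neighbours of [T] are the trees [T + a - b] where the edge [a] of [G]
    crosses the cut of [T - b].  Two neighbours with the same [a] or the same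
    [b] are equal or adjacent, so the neighbourhood of [T] is connected as soon
    as the relation that some edge crosses the cuts of both [T - b] and
    [T - b'] connects all edges of [T] ([crossed_propagate]).  Since [T] is
    connected, it is enough to treat two edges of [T] at a common vertex [v].
    Deleting [v] leaves one branch of [T] behind each edge at [v]; as [G - v] is
    connected, one can walk in it from one branch to the other, and each step
    of the walk that leaves the branch behind [vw] for the branch behind [vw']
    crosses the cuts of both [T - vw] and [T - vw'].

    Spanning trees are handled as connected edge sets all of whose edges are
    bridges ([spanning_treeP]); exchange and the connectedness of [Aux G]
    ([Aux_connected]) follow from the effect of one edge on the relation
    [linked] of being joined by edges of a given set ([linkedU1]). *)

(** * Connectivity by invariants *)

Lemma connect_inv (T : finType) (e : rel T) (P : T -> Prop) (x y : T) :
  (forall z t, e z t -> P z -> P t) -> connect e x y -> P x -> P y.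
Proof.
move=> Pe /connectP[p]; elim: p x => [|t p IHp] x /= => [_ -> //|].
by case/andP=> /Pe ext /IHp ind /ind{}ind /ext.
Qed.

Lemma connected_inv {H : sgraph} (P : H -> Prop) (x y : H) :
    connected H -> (forall z t, adj z t -> P z -> P t) -> P x -> P y.
Proof.
by case/andP=> _ /forallP/(_ x)/forallP/(_ y) cxy /connect_inv; apply.
Qed.

Lemma connected_induced_inv {H : sgraph} {S : {set H}} (P : H -> Prop)
    (x y : H) :
    connected (induced S) ->
    (forall z t, z \in S -> t \in S -> adj z t -> P z -> P t) ->
  x \in S -> y \in S -> P x -> P y.
Proof.
move=> cS Pe xS yS; pose Q (z : induced S) := P (val z).
apply: (@connected_inv _ Q (exist _ x xS) (exist _ y yS)) cS _ => z t.
by apply: Pe; apply: valP.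
Qed.

(** A boolean invariant suffices, as being joined to [x] inside [S] is itself
    such an invariant. *)
Lemma connected_inducedI {H : sgraph} {S : {set H}} (x : H) :
    x \in S ->
    (forall P : pred H,
       (forall z t, z \in S -> t \in S -> adj z t -> P z -> P t) ->
       P x -> forall y, y \in S -> P y) ->
  connected (induced S).
Proof.
move=> xS inv; pose x' : induced S := exist _ x xS.
have cx y : connect (@adj (induced S)) x' y.
  pose P z := [exists t : induced S, (val t == z) && connect (@adj _) x' t].
  have: P (val y).
    apply: inv (valP y) => [z t zS tS zt|]; last first.
      by apply/existsP; exists x'; rewrite eqxx connect0.
    case/existsP=> z' /andP[/eqP zz' cz']; apply/existsP.
    exists (exist _ t tS); rewrite eqxx /=.
    by apply: connect_trans cz' (connect1 _); rewrite /= /induced_adj zz'.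
  by case/existsP=> t /andP[/eqP/val_inj <-].
apply/andP; split; first by apply/card_gt0P; exists x'.
apply/forallP=> y; apply/forallP=> z; apply: connect_trans (cx z).
by rewrite sym_connect_sym //; apply: adj_sym.
Qed.

(** * Locally connected graphs are prime *)

Lemma isomorphic_complete1 (H : sgraph) (x : H) :
  (forall y, y = x) -> isomorphic H (complete 1).
Proof.
move=> Hx; exists (fun=> ord0); split.
  by exists (fun=> x) => y; [rewrite (Hx y) | rewrite [y]ord1].
by move=> y z; rewrite (Hx y) (Hx z) !adj_irrefl.
Qed.

(** Transport the graph to a product [H1 * H2].  If the first coordinate of [x]
    has no neighbour in [H1] then no edge ever changes that coordinate, so
    connectedness makes [H1] trivial; likewise for [H2].  Otherwise [x] has
    neighbours [yu] and [yv] in the two directions, while moving along an edge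
    inside the neighbourhood of [x] never switches the direction. *)
Lemma prime_of_connected_link (H : sgraph) (x : H) :
    connected H -> connected (induced [set y | adj x y]) -> prime_graph H.
Proof.
move=> cH cx; have [y0 xy0] : exists y, adj x y.
  by case/andP: cx => /card_gt0P[[y yS] _] _; exists y; rewrite inE in yS.
split=> [[f [/bij_inj f_inj _]] | H1 H2 [f [[g fK gK] f_adj]]].
  suff xy : x = y0 by rewrite -xy adj_irrefl in xy0.
  by apply: f_inj; rewrite [f x]ord1 [f y0]ord1.
have f_adjE y z : adj y z =
    ((f y).1 == (f z).1) && adj (f y).2 (f z).2
    || adj (f y).1 (f z).1 && ((f y).2 == (f z).2).
  by rewrite -f_adj.
have inv (P : H -> Prop) y :
    (forall z t, adj z t -> P z -> P t) -> P x -> P y.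
  exact: connected_inv.
have [u /= xu | no1] := pickP (adj (f x).1); last first.
  left; apply: (@isomorphic_complete1 _ (f x).1) => u.
  rewrite -[u]/((u, (f x).2).1) -[(u, _)]gK.
  apply: (inv (fun y => (f y).1 = (f x).1)) => // z t; rewrite f_adjE.
  by case/orP=> /andP[+ _] => [/eqP<- //|] + zx; rewrite zx no1.
have [v /= xv | no2] := pickP (adj (f x).2); last first.
  right; apply: (@isomorphic_complete1 _ (f x).2) => v.
  rewrite -[v]/(((f x).1, v).2) -[(_, v)]gK.
  apply: (inv (fun y => (f y).2 = (f x).2)) => // z t; rewrite f_adjE.
  by case/orP=> /andP[_ +] => [|/eqP<- //] + zx; rewrite zx no2.
pose yu := g (u, (f x).2); pose yv := g ((f x).1, v).
have xyu : yu \in [set y | adj x y] by rewrite inE f_adjE gK /= xu eqxx orbT.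
have xyv : yv \in [set y | adj x y] by rewrite inE f_adjE gK /= xv eqxx.
suff: (f yu).1 = (f x).1 by rewrite gK /= => ux; rewrite ux adj_irrefl in xu.
apply: (connected_induced_inv (P := fun y => (f y).1 = (f x).1) cx _ xyv xyu).
  move=> z t; rewrite !inE !f_adjE => xz xt zt zx; rewrite zx in xz zt.
  case/orP: zt => /andP[]; first by move/eqP.
  move=> xt1 /eqP zt2; case/orP: xz => /andP[]; last by rewrite adj_irrefl.
  rewrite zt2 => _ xz2; case/orP: xt => /andP[]; first by move/eqP.
  by move=> _ /eqP xt2; rewrite xt2 adj_irrefl in xz2.
by rewrite gK.
Qed.

(** * Vertices linked by a set of edges *)

Lemma set2_inj (T : finType) (x y z t : T) :
  [set x; y] = [set z; t] -> x = z /\ y = t \/ x = t /\ y = z.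
Proof.
move=> E; have [xE yE] := (set21 x y, set22 x y); rewrite E !inE in xE yE.
have [zE tE] := (set21 z t, set22 z t); rewrite -E !inE in zE tE.
by case/orP: xE yE zE tE => /eqP? /orP[]/eqP? /orP[]/eqP? /orP[]/eqP?;
  subst; auto.
Qed.

Section Linked.
Variable G : sgraph.
Implicit Types (F : {set {set G}}) (x y u v w : G).

Definition linked F : rel G := connect (@spanning_adj G F).

Lemma linked_refl F x : linked F x x. Proof. exact: connect0. Qed.

Lemma linked_sym F x y : linked F x y = linked F y x.
Proof. by apply: sym_connect_sym; apply: spanning_sym. Qed.

Lemma linked_trans F y x z : linked F x y -> linked F y z -> linked F x z.
Proof. exact: connect_trans. Qed.

Lemma linked_edge F x y : [set x; y] \in F -> linked F x y.
Proof.
move=> xyF; have [->|xy] := eqVneq x y; first exact: linked_refl.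
by apply: connect1; rewrite /spanning_adj xy.
Qed.

Lemma linked_inv F (P : G -> Prop) x y :
    (forall z t, [set z; t] \in F -> P z -> P t) ->
  linked F x y -> P x -> P y.
Proof. by move=> PF; apply: connect_inv => z t /andP[_ /PF]. Qed.

Lemma linked_sub F F' x y : F \subset F' -> linked F x y -> linked F' x y.
Proof.
move=> /subsetP sFF' /(linked_inv (P := linked F' x)); apply=> [z t ztF xz|].
  by apply: linked_trans xz (linked_edge _); apply: sFF'.
exact: linked_refl.
Qed.

(** A path using the new edge may be taken to use it once. *)
Lemma linkedU1 F x y u v : linked ([set x; y] |: F) u v ->
  [\/ linked F u v, linked F u x /\ linked F y v
   | linked F u y /\ linked F x v].
Proof.
pose P z := [\/ linked F u z, linked F u x /\ linked F y z
   | linked F u y /\ linked F x z].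
move/(linked_inv (P := P)); apply; last exact: Or31 (linked_refl _ _).
move=> z t; rewrite !inE => /orP[/eqP/set2_inj[] [-> ->] | /linked_edge zt].
- by case=> [ux | [ux _] | [uy _]]; [apply: Or32 | apply: Or32 | apply: Or31];
    rewrite ?linked_refl.
- by case=> [ux | [ux _] | [uy _]]; [apply: Or33 | apply: Or31 | apply: Or33];
    rewrite ?linked_refl.
case=> [uz | [ux yz] | [uy xz]]; [apply: Or31 | apply: Or32 | apply: Or33].
- exact: linked_trans zt.
- by split=> //; apply: linked_trans zt.
- by split=> //; apply: linked_trans zt.
Qed.

(** The path misses the vertex [x], hence every edge at [x]. *)
Lemma linked_path_avoid F x y w p :
    path (@spanning_adj G F) y p -> x \notin y :: p ->
  linked (F :\ [set x; w]) y (last y p).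
Proof.
elim: p y => [|z p IHp] y /=; first by rewrite linked_refl.
case/andP=> /andP[_ yzF] /IHp{}IHp; rewrite inE negb_or => /andP[xy xp].
apply: linked_trans (IHp xp); apply: linked_edge; rewrite !inE yzF andbT.
apply: contraNneq xp => yz; have := set21 x w.
by rewrite -yz !inE (negbTE xy) => /= ->.
Qed.

(** A simple path from [x] does not return to [x] after its first edge. *)
Lemma linked_first_edge F x y : linked F x y -> x != y ->
  exists2 z, [set x; z] \in F & linked (F :\ [set x; z]) z y.
Proof.
case/connectP=> p0 /shortenP[[|z p] Fp x_p _ ->]; first by rewrite eqxx.
case/andP: Fp x_p => /andP[_ xzF] Fp /andP[x_p _] _; exists z => //.
exact: linked_path_avoid.
Qed.

(** * Spanning trees as connected sets of bridges *)

Lemma edgesE x y : ([set x; y] \in edges G) = adj x y.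
Proof.
apply/imsetP/idP => [[[u v]] | xy]; last by exists (x, y); rewrite ?inE.
by rewrite inE /= => uv /set2_inj[] [-> ->]; rewrite // adj_sym.
Qed.

Lemma edgesP e : e \in edges G -> exists x y, e = [set x; y].
Proof. by case/imsetP=> -[x y] _ ->; exists x, y. Qed.

Definition bridge_tree F :=
  [/\ F \subset edges G, forall x y, linked F x y
    & forall x y, [set x; y] \in F -> ~~ linked (F :\ [set x; y]) x y].

(** An edge lies on a cycle exactly when its ends remain linked once it is
    deleted: the rest of the cycle links them, and conversely a simple path
    between them, of length at least two, is closed by the edge. *)
Lemma spanning_treeP F :
  0 < #|G| -> reflect (bridge_tree F) (spanning_tree F).
Proof.
move=> G_gt0; have Fneq x y : F \subset edges G -> [set x; y] \in F -> x != y.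
  move=> /subsetP sFE /sFE; rewrite edgesE.
  by apply: contraTneq => ->; rewrite adj_irrefl.
apply: (iffP and3P) => [] [sFE F_conn F_bridge]; split=> //.
- by case/andP: F_conn => _ /forallP F_conn x y; apply: (forallP (F_conn x)).
- move=> x y xyF; apply/negP=> /connectP[p0 /shortenP[p Fp x_p _ y_p]].
  have /acyclicP/(_ (x :: p)) := F_bridge; apply.
    case: p => [|z [|t p]] // in Fp x_p y_p *.
      by have:= Fneq _ _ sFE xyF; rewrite y_p eqxx.
    by move: Fp; rewrite y_p /= /spanning_adj !inE eqxx andbF.
  rewrite /ucycle x_p andbT /= rcons_path -y_p [spanning_adj F y x]spanning_sym.
  rewrite /spanning_adj xyF Fneq // !andbT.
  apply: (sub_path _ Fp) => z t /andP[zt]; rewrite !inE => /andP[_ ztF].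
  by rewrite /= zt.
- rewrite /connected G_gt0; apply/forallP=> x; apply/forallP=> y.
  exact: F_conn.
apply/acyclicP=> [[|x [|y [|z p]]]] //= _ /andP[].
rewrite -[cycle _ _]/(spanning_adj F x y && path _ y (rcons (z :: p) x)).
rewrite rcons_path => /and3P[/andP[_ xyF] Fp /andP[_ zxF]].
case/and3P=> x_p y_p _; have /negP := F_bridge x y xyF; apply.
rewrite linked_sym; apply: linked_trans (linked_path_avoid _ Fp x_p) _.
apply: linked_edge; rewrite !inE zxF andbT.
apply/eqP=> /set2_inj[] [lx ly]; last by rewrite -lx /= mem_last in y_p.
by rewrite -ly mem_head in x_p.
Qed.

Lemma bridge_tree_edgeP F e : bridge_tree F -> e \in F ->
  exists x y, e = [set x; y].
Proof. by case=> /subsetP sFE _ _ /sFE/edgesP. Qed.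

Lemma linked_edgeD F e x y :
  [set x; y] \in F -> [set x; y] != e -> linked (F :\ e) x y.
Proof. by move=> xyF xy_e; apply: linked_edge; rewrite !inE xy_e. Qed.

Lemma linkedD1 F x y u v : [set x; y] \in F -> linked F u v ->
  [\/ linked (F :\ [set x; y]) u v,
      linked (F :\ [set x; y]) u x /\ linked (F :\ [set x; y]) y v
    | linked (F :\ [set x; y]) u y /\ linked (F :\ [set x; y]) x v].
Proof. by move=> xyF; rewrite -{1}(setD1K xyF); apply: linkedU1. Qed.

(** A connecting set of edges of least size has only bridges: deleting an edge
    with linked ends would leave a smaller connecting set. *)
Lemma bridge_tree_exists : connected G -> exists F, bridge_tree F.
Proof.
move=> cG.
pose P F := (F \subset edges G) && [forall x, forall y, linked F x y].
have PE : P (edges G).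
  rewrite /P subxx; apply/forallP=> x; apply/forallP=> y.
  apply: (connected_inv (P := linked (edges G) x) _ cG _ (linked_refl _ _)).
  move=> z t zt xz; apply: linked_trans xz (linked_edge _).
  by rewrite edgesE.
have [F /andP[sFE F_conn] F_min] := arg_minnP (fun F => #|F|) PE.
have {}F_conn x y : linked F x y by have /forallP := forallP F_conn x; apply.
exists F; split=> // x y xyF; apply/negP=> xy.
suff /F_min : P (F :\ [set x; y]).
  by rewrite [#|F|](cardsD1 [set x; y]) xyF ltnn.
rewrite /P (subset_trans (subD1set _ _) sFE).
apply/forallP=> z; apply/forallP=> t.
have [// | [zx yt] | [zy xt]] := linkedD1 xyF (F_conn z t).
  exact: linked_trans zx (linked_trans xy yt).
by rewrite linked_sym in xy; apply: linked_trans zy (linked_trans xy xt).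
Qed.

Lemma bridge_tree_sub_eq F F' :
  bridge_tree F -> bridge_tree F' -> F \subset F' -> F = F'.
Proof.
move=> [_ F_conn _] F'tree sFF'; apply/eqP; rewrite eqEsubset sFF'.
apply/subsetP=> e eF'; have [x [y xy]] := bridge_tree_edgeP F'tree eF'.
rewrite {}xy in eF' *; case: F'tree => _ _ /(_ x y eF').
apply: contraNT => xyF; apply: linked_sub (F_conn x y).
by rewrite subsetD1 sFF'.
Qed.

Lemma unlinked_edge D F u v : linked F u v -> ~~ linked D u v ->
  exists x y, [set x; y] \in F /\ ~~ linked D x y.
Proof.
move=> uvF uvD; pose Q (p : G * G) :=
  ([set p.1; p.2] \in F) && ~~ linked D p.1 p.2.
have [[x y] /andP[xyF xyD] | noQ] := pickP Q; first by exists x, y.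
case/negP: uvD; apply: (linked_inv (P := linked D u) _ uvF (linked_refl _ _)).
move=> z t ztF uz; apply: linked_trans uz _; move: (noQ (z, t)).
by rewrite /Q /= ztF => /negbFE.
Qed.

(** Deleting [uv] leaves two sides, one of which contains [x] and the other
    [y]; the edge [xy] joins them again.  An edge [pq] of the new set that were
    not a bridge would either lie on a cycle of the old tree, or lie on a cycle
    through [xy], and then [x] and [y] would be linked without [xy]. *)
Lemma bridge_tree_exchange F x y u v :
    bridge_tree F -> [set u; v] \in F -> adj x y ->
    ~~ linked (F :\ [set u; v]) x y ->
  bridge_tree ([set x; y] |: (F :\ [set u; v])).
Proof.
move=> [sFE F_conn F_bridge] uvF xyG; set D := F :\ _; set F' := _ |: D => xyD.
have sDF' : D \subset F' by apply: subsetUr.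
have xyF' : linked F' x y by apply: linked_edge; rewrite !inE eqxx.
have side z : linked D z u \/ linked D z v.
  by case: (linkedD1 uvF (F_conn z u)) => [|[]|[]]; auto.
have two_sides z : linked D z x \/ linked D z y.
  have glue w t p : linked D t w -> linked D p w -> linked D t p.
    by rewrite (linked_sym _ p); apply: linked_trans.
  move: (side z) (side x) (side y) => [zu|zv] [xu|xv] [yu|yv];
    try by [left; apply: glue zu xu | left; apply: glue zv xv
           | right; apply: glue zu yu | right; apply: glue zv yv].
  - by case/negP: xyD; apply: glue xv yv.
  - by case/negP: xyD; apply: glue xu yu.
have to_x z : linked F' z x.
  have [/(linked_sub sDF') // | /(linked_sub sDF') zy] := two_sides z.
  by apply: linked_trans zy _; rewrite linked_sym.
split=> [|z t|p q].
- rewrite subUset sub1set edgesE xyG /=.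
  exact: subset_trans (subD1set _ _) sFE.
- by apply: linked_trans (to_x z) _; rewrite linked_sym.
have xy_nD : [set x; y] \notin D by apply: contra xyD; apply: linked_edge.
rewrite inE in_set1 => /orP[/eqP pq_xy | pqD].
  have D_xy : F' :\ [set x; y] = D by rewrite setU1K.
  have [[-> ->] | [-> ->]] := set2_inj pq_xy; first by rewrite D_xy.
  by rewrite setUC D_xy linked_sym.
have pqF : [set p; q] \in F by move: pqD; rewrite inE => /andP[].
have pq_xy : [set p; q] != [set x; y] by apply: contraNneq xy_nD => <-.
have -> : F' :\ [set p; q] = [set x; y] |: (D :\ [set p; q]).
  apply/setP=> e; rewrite !inE.
  by have [->|] := eqVneq e [set p; q]; rewrite ?(negbTE pq_xy).
have sD'D : D :\ [set p; q] \subset D by apply: subD1set.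
have pq : linked D p q by apply: linked_edge.
apply/negP=> /linkedU1[pq' | [px yq] | [py xq]].
- case/negP: (F_bridge p q pqF); apply: linked_sub pq'.
  by apply: setSD; apply: subD1set.
- case/negP: xyD; rewrite linked_sym.
  apply: linked_trans (linked_sub sD'D yq) _.
  by rewrite linked_sym in pq; apply: linked_trans pq (linked_sub sD'D px).
case/negP: xyD; apply: linked_trans (linked_sub sD'D xq) _.
by rewrite linked_sym in pq; apply: linked_trans pq (linked_sub sD'D py).
Qed.

(** * The fundamental graph of a spanning tree *)

(** Below, the vertices [z] with [linked (F :\ [set v; w]) w z] form the branch
    of the tree [F] at [v] behind its edge [vw].  Inside that branch another
    edge at [v] is of no use, since reaching it means reaching [v]. *)
Lemma branch_avoid F v w1 w2 z :
    bridge_tree F -> [set v; w1] \in F -> [set v; w2] \in F -> w1 != w2 ->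
    linked (F :\ [set v; w1]) w1 z ->
  linked (F :\ [set v; w1] :\ [set v; w2]) w1 z.
Proof.
move=> [_ _ F_bridge] vw1 vw2 w12 w1z; have := F_bridge v w1 vw1.
rewrite linked_sym.
have vw2' : [set v; w2] \in F :\ [set v; w1].
  rewrite !inE vw2 andbT; apply: contra_neq w12 => /esym.
  by case/set2_inj=> [] [] // -> ->.
have sub := linked_sub (subD1set (F :\ [set v; w1]) [set v; w2]).
case: (linkedD1 vw2' w1z) => [// | [/sub -> //] | [/sub w1w2 _] /negP[]].
by apply: linked_trans w1w2 _; apply: linked_edge; rewrite setUC.
Qed.

Lemma branch_disjoint F v w1 w2 z :
    bridge_tree F -> [set v; w1] \in F -> [set v; w2] \in F ->
    linked (F :\ [set v; w1]) w1 z -> linked (F :\ [set v; w2]) w2 z ->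
  w1 = w2.
Proof.
move=> Ft vw1 vw2 w1z w2z; apply: contraTeq isT => w12.
have {}w1z := branch_avoid Ft vw1 vw2 w12 w1z.
rewrite eq_sym in w12; have {}w2z := branch_avoid Ft vw2 vw1 w12 w2z.
have [_ _ /(_ v w1 vw1)/negP[]] := Ft.
have vw2' : [set v; w2] \in F :\ [set v; w1].
  rewrite !inE vw2 andbT; apply: contra_neq w12.
  by case/set2_inj=> [] [] // -> ->.
apply: linked_trans (linked_edge vw2') _.
apply: linked_sub (subD1set _ [set v; w2]) _; rewrite linked_sym in w1z.
by apply: linked_trans w1z; rewrite setDDl setUC -setDDl.
Qed.

(** [K] stands for a property of tree edges that is passed from [b] to [b']
    whenever one edge [xy] of the graph crosses the cuts of both [F - b] and
    [F - b'], that is, whenever [b] and [b'] lie in one fundamental cycle. *)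
Section Propagation.
Variables (F : {set {set G}}) (K : {set G} -> Prop).
Hypothesis F_tree : bridge_tree F.
Hypothesis K_crossed : forall b b' x y, b \in F -> b' \in F -> adj x y ->
  ~~ linked (F :\ b) x y -> ~~ linked (F :\ b') x y -> K b -> K b'.

(** The set [S] of vertices lying in a branch behind an edge with property [K]
    is preserved by each edge [zz'] of [G - v]: either [z'] is in the branch of
    [z], or [zz'] crosses the cuts of the edges leading to both branches.  So
    [S] contains [w'], whose only branch is the one behind [vw']. *)
Lemma crossed_propagate_star v w w' : connected (induced (~: [set v])) ->
    [set v; w] \in F -> [set v; w'] \in F -> K [set v; w] ->
  K [set v; w'].
Proof.
have [sFE F_conn _] := F_tree.
have neq_v t : [set v; t] \in F -> t \in ~: [set v].
  move/(subsetP sFE); rewrite edgesE !inE.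
  by apply: contraTneq => ->; rewrite adj_irrefl.
move=> Gv vw vw' Kw; have [wV w'V] := (neq_v _ vw, neq_v _ vw').
pose S z := exists t,
  [/\ [set v; t] \in F, K [set v; t] & linked (F :\ [set v; t]) t z].
suff [t [vt Kt tw']] : S w'.
  by rewrite -(branch_disjoint F_tree vt vw' tw' (linked_refl _ _)).
apply: (connected_induced_inv (P := S) Gv _ wV w'V); last first.
  by exists w; rewrite linked_refl.
move=> z z' _ z'V zz' [t [vt Kt tz]].
have [t' vt' t'z'] : exists2 t', [set v; t'] \in F
    & linked (F :\ [set v; t']) t' z'.
  by apply: linked_first_edge (F_conn v z') _; rewrite !inE eq_sym in z'V.
exists t'; split=> //; have [<- // | tt'] := eqVneq t t'.
apply: (K_crossed vt vt' zz') Kt; apply: contra tt' => zz'F.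
  have tz' := linked_trans tz zz'F.
  by rewrite (branch_disjoint F_tree vt vt' tz' t'z').
rewrite linked_sym in zz'F; have t'z := linked_trans t'z' zz'F.
by rewrite (branch_disjoint F_tree vt vt' tz t'z).
Qed.

(** Having [K] for all tree edges at a vertex spreads along tree edges. *)
Lemma crossed_propagate b b' :
    (forall v, connected (induced (~: [set v]))) ->
  b \in F -> b' \in F -> K b -> K b'.
Proof.
move=> Gv bF b'F; have [_ F_conn _] := F_tree.
have [v [w bE]] := bridge_tree_edgeP F_tree bF.
have [v' [w' b'E]] := bridge_tree_edgeP F_tree b'F.
rewrite {}bE {}b'E in bF b'F * => Kb.
pose Q z := forall t, [set z; t] \in F -> K [set z; t].
suff : Q v' by apply.
apply: (linked_inv (P := Q) _ (F_conn v v')) => [z t ztF Qz p tpF | t vtF].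
  have := Qz t ztF; rewrite setUC in ztF *.
  exact: crossed_propagate_star.
exact: crossed_propagate_star Kb.
Qed.

End Propagation.

(** The vertex [t] witnesses that the side of [u] is not reduced to [u]; then a
    path from [t] to [v] in [G - u] changes sides along an edge that differs
    from [uv] because it avoids [u]. *)
Lemma bridge_crossed F u v t :
    connected (induced (~: [set u])) -> bridge_tree F -> [set u; v] \in F ->
    u != v -> u != t -> linked (F :\ [set u; v]) u t ->
  exists x y, [/\ adj x y, [set x; y] \notin F
                & ~~ linked (F :\ [set u; v]) x y].
Proof.
move=> Gu [_ _ F_bridge] uvF uv ut cut; set D := F :\ _ in cut *.
have [xy /and4P[xyG xu yu xyD] | noxy] := pickP (fun p : G * G =>
    [&& adj p.1 p.2, u != p.1, u != p.2 & ~~ linked D p.1 p.2]).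
  exists xy.1, xy.2; split=> //; apply: contra xyD => /linked_edgeD; apply.
  apply/eqP=> /esym E; have := set21 u v.
  by rewrite E !inE (negbTE xu) (negbTE yu).
have tV : t \in ~: [set u] by rewrite !inE eq_sym.
have vV : v \in ~: [set u] by rewrite !inE eq_sym.
case/negP: (F_bridge u v uvF).
apply: (connected_induced_inv (P := linked D u) Gu _ tV vV) cut => z z'.
rewrite !inE !(eq_sym _ u) => uz uz' zz' cuz; apply: linked_trans cuz _.
by move: (noxy (z, z')); rewrite /= uz uz' zz' => /negbFE.
Qed.

End Linked.

(** * The neighbourhood of a tree in the auxiliary graph *)

Section AuxTheory.
Variable G : sgraph.
Hypothesis G_gt0 : 0 < #|G|.
Implicit Types T : Aux G.

Lemma Aux_bridge_tree T : bridge_tree (val T).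
Proof. by apply/spanning_treeP=> //; apply: (valP T). Qed.

Lemma Aux_adjI T T' a b : a \notin val T -> b \in val T ->
  val T' = a |: (val T :\ b) -> adj T T'.
Proof.
move=> aT bT T'E; apply/exists_inP; exists a.
  have [/subsetP sT'E _ _] := Aux_bridge_tree T'.
  by rewrite inE aT; apply: sT'E; rewrite T'E !inE eqxx.
apply/exists_inP; exists b => //; apply/eqP/setP=> e; rewrite T'E !inE.
have [->|] // := eqVneq e a; rewrite andbT; symmetry.
by apply: contraNneq aT => ->.
Qed.

Lemma Aux_adjP T T' : adj T T' ->
  exists a b, [/\ a \notin val T, b \in val T & val T' = a |: (val T :\ b)].
Proof.
case/exists_inP=> a; rewrite inE => /andP[aT _].
case/exists_inP=> b bT /eqP T'E; exists a, b; split=> //.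
apply/setP=> e; rewrite T'E !inE.
by have [->|] // := eqVneq e a; rewrite andbT; apply: contraNneq aT => ->.
Qed.

Lemma Aux_exchange T b x y : b \in val T -> adj x y ->
    ~~ linked (val T :\ b) x y ->
  exists T', val T' = [set x; y] |: (val T :\ b).
Proof.
move=> bT xy; have [u [v bE]] := bridge_tree_edgeP (Aux_bridge_tree T) bT.
rewrite {}bE in bT * => xyT.
have Tt := Aux_bridge_tree T.
have /(spanning_treeP _ G_gt0) := bridge_tree_exchange Tt bT xy xyT.
by move=> T't; exists (exist (@spanning_tree G) _ T't).
Qed.

(** For a tree edge [uv] outside [T'], the tree [T'] contains an edge crossing
    the cut of [T - uv]; exchanging the two brings [T] closer to [T']. *)
Lemma Aux_connected : connected G -> connected (Aux G).
Proof.
move=> cG; rewrite /connected; apply/andP; split.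
  have [F /(spanning_treeP _ G_gt0) Ft] := bridge_tree_exists cG.
  by apply/card_gt0P; exists (exist (@spanning_tree G) F Ft).
apply/forallP=> T; apply/forallP=> T'.
have [n] := ubnP #|val T' :\: val T|; elim: n T => // n IHn T ltn.
have [/eqP/val_inj-> // | TT'] := boolP (val T == val T').
have [Tt T't] := (Aux_bridge_tree T, Aux_bridge_tree T').
have /subsetPn[b bT bT'] : ~~ (val T \subset val T').
  by apply: contra TT' => /(bridge_tree_sub_eq Tt T't)->.
have [u [v bE]] := bridge_tree_edgeP Tt bT; rewrite {}bE in bT bT'.
have [[_ _ T_bridge] [sT'E T'_conn _]] := (Tt, T't).
have [x [y [xyT' xyD]]] := unlinked_edge (T'_conn u v) (T_bridge u v bT).
have xyT : [set x; y] \notin val T.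
  apply: contra xyD => /linked_edgeD; apply.
  by apply: contraNneq bT' => <-.
have xyG : adj x y by rewrite -edgesE (subsetP sT'E).
have [T1 T1E] := Aux_exchange bT xyG xyD.
apply: connect_trans (connect1 (Aux_adjI xyT bT T1E)) (IHn _ _).
apply: leq_trans (ltn : #|_| <= n); apply: proper_card.
apply/properP; split.
  apply/subsetP=> e; rewrite T1E !inE => /andP[+ eT'].
  rewrite eT' andbT !negb_or => /andP[_]; apply: contra => ->.
  by rewrite andbT; apply: contraNneq bT' => <-.
by exists [set x; y]; rewrite ?T1E !inE ?eqxx ?xyT.
Qed.

Lemma Aux_adj_same_edge_out T T1 T2 a1 a2 b :
    a1 \notin val T -> a2 \notin val T ->
    val T1 = a1 |: (val T :\ b) -> val T2 = a2 |: (val T :\ b) ->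
  T1 = T2 \/ adj T1 T2.
Proof.
move=> a1T a2T T1E T2E; have [a12 | a12] := eqVneq a1 a2.
  by left; apply: val_inj; rewrite T1E T2E a12.
right; apply: (@Aux_adjI _ _ a2 a1); rewrite T1E ?inE ?eqxx //.
  by rewrite eq_sym negb_or a12 negb_and a2T orbT.
by rewrite T2E setU1K // !inE (negbTE a1T) andbF.
Qed.

Lemma Aux_adj_same_edge_in T T1 T2 a b1 b2 :
    a \notin val T -> b1 \in val T -> b2 \in val T ->
    val T1 = a |: (val T :\ b1) -> val T2 = a |: (val T :\ b2) ->
  T1 = T2 \/ adj T1 T2.
Proof.
move=> aT b1T b2T T1E T2E; have [b12 | b12] := eqVneq b1 b2.
  by left; apply: val_inj; rewrite T1E T2E b12.
have neq_a b : b \in val T -> b != a by apply: contraTneq => ->.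
right; apply: (@Aux_adjI _ _ b1 b2); rewrite T1E ?inE.
- by rewrite eqxx orbF neq_a.
- by rewrite b2T (eq_sym b2 b1) b12 orbT.
apply/setP=> e; rewrite T2E !inE.
have [-> | eb1] /= := eqVneq e b1; first by rewrite b12 b1T orbT.
have [-> | ea] //= := eqVneq e a.
by rewrite andbT eq_sym neq_a.
Qed.

(** The property propagated along the edges [b] of [T] is that [P] holds at all
    neighbours [T + a - b].  If [xy] crosses the cuts of [T - b1] and [T - b2],
    then [T + xy - b1] and [T + xy - b2] are neighbours of [T] that are
    adjacent to each other, and the second is adjacent to every other neighbour
    of [T] in which [b2] is removed. *)
Lemma Aux_link_connected T :
    2 < #|G| -> (forall v : G, connected (induced (~: [set v]))) ->
  connected (induced [set T' | adj T T']).
Proof.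
move=> G_gt2 Gv; have Tt := Aux_bridge_tree T; have [sTE T_conn T_bridge] := Tt.
have [T0 TT0] : exists T0, adj T T0.
  have /card_gt1P[p [q [_ _ pq]]] := ltnW G_gt2.
  have [r prT _] := linked_first_edge (T_conn p q) pq.
  have pr : p != r.
    have := subsetP sTE _ prT; rewrite edgesE.
    by apply: contraTneq => ->; rewrite adj_irrefl.
  (* A third vertex makes one side of the cut of [T - pr] larger than one
     point. *)
  have /subsetPn[t _] : ~~ ([set: G] \subset [set p; r]).
    apply: contraL G_gt2 => /subset_leq_card.
    by rewrite cardsT cards2 pr -leqNgt.
  rewrite !inE negb_or => /andP[tp tr].
  have [x [y [xyG xyT xyD]]] : exists x y, [/\ adj x y,
      [set x; y] \notin val T & ~~ linked (val T :\ [set p; r]) x y].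
    rewrite eq_sym in tp; rewrite eq_sym in tr.
    have [pt | [_ rt] | [_ pt]] := linkedD1 prT (T_conn p t).
    + exact: (bridge_crossed _ Tt prT _ tp pt).
    + rewrite setUC in prT rt *; rewrite eq_sym in pr.
      exact: (bridge_crossed _ Tt prT _ tr rt).
    + exact: (bridge_crossed _ Tt prT _ tp pt).
  have [T0 T0E] := Aux_exchange prT xyG xyD.
  by exists T0; apply: Aux_adjI T0E.
have T0N : T0 \in [set T' | adj T T'] by rewrite inE.
apply: (connected_inducedI T0N) => P P_adj PT0 T' T'N.
have {}P_adj T1 T2 :
    adj T T1 -> adj T T2 -> T1 = T2 \/ adj T1 T2 -> P T1 -> P T2.
  by move=> TT1 TT2 [-> // | T12]; apply: P_adj; rewrite ?inE.
pose K b := forall T1 a, a \notin val T -> val T1 = a |: (val T :\ b) -> P T1.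
have [a0 [b0 [a0T b0T T0E]]] := Aux_adjP TT0.
have [a' [b' [a'T b'T T'E]]] : exists a b,
    [/\ a \notin val T, b \in val T & val T' = a |: (val T :\ b)].
  by apply: Aux_adjP; rewrite inE in T'N.
suff: K b' by apply; [exact: a'T | exact: T'E].
apply: (crossed_propagate Tt _ Gv b0T b'T).
  move=> b1 b2 x y b1T b2T xy xyb1 xyb2 Kb1.
  have [<- // | b12] := eqVneq b1 b2.
  (* A tree edge crosses only the cut that it defines itself. *)
  have xyT : [set x; y] \notin val T.
    apply: contra b12 => xyT.
    have /eqP <- : [set x; y] == b1.
      by apply: contraNT xyb1 => /(linked_edgeD xyT).
    by apply: contraNT xyb2 => /(linked_edgeD xyT).
  have [T1 T1E] := Aux_exchange b1T xy xyb1.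
  have [T2 T2E] := Aux_exchange b2T xy xyb2.
  have PT2 : P T2.
    apply: P_adj (Kb1 _ _ xyT T1E).
    - exact: Aux_adjI T1E.
    - exact: Aux_adjI T2E.
    exact: Aux_adj_same_edge_in T1E T2E.
  move=> T3 a aT T3E; apply: P_adj PT2.
  - exact: Aux_adjI T2E.
  - exact: Aux_adjI T3E.
  exact: Aux_adj_same_edge_out T2E T3E.
move=> T1 a aT T1E; apply: P_adj PT0 => //; first exact: Aux_adjI T1E.
exact: Aux_adj_same_edge_out T0E T1E.
Qed.

End AuxTheory.

(** * Two-connected graphs *)

Lemma two_connected_connected (G : sgraph) : two_connected G -> connected G.
Proof.
case/andP=> /ltnW G_gt0 /forallP/(_ set0); rewrite cards0 setC0 /= => cT.
rewrite /connected G_gt0; apply/forallP=> x; apply/forallP=> y.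
have inT z : z \in [set: G] by rewrite inE.
pose P := connect (@adj G) x.
apply: (connected_induced_inv (P := P) cT _ (inT x) (inT y)); last first.
  exact: connect0.
by move=> z t _ _ zt xz; apply: connect_trans xz (connect1 zt).
Qed.

Lemma two_connected_del (G : sgraph) (v : G) :
  two_connected G -> connected (induced (~: [set v])).
Proof. by case/andP=> _ /forallP/(_ [set v]); rewrite cards1. Qed.

Lemma connected_card2 (G : sgraph) :
  connected G -> #|G| = 2 -> isomorphic G (complete 2).
Proof.
move=> cG G2; exists (fun x => cast_ord G2 (enum_rank x)); split.
  apply: inj_card_bij; last by rewrite card_ord G2.
  by move=> x y /cast_ord_inj/enum_rank_inj.
move=> x y; rewrite /= /complete_adj (inj_eq (@cast_ord_inj _ _ _)).
rewrite (inj_eq enum_rank_inj); have [-> | xy] := eqVneq x y.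
  by rewrite adj_irrefl.
have G_xy t : t \in [set x; y].
  suff -> : [set x; y] = setT by rewrite inE.
  by apply/eqP; rewrite eqEcard subsetT cardsT cards2 xy G2.
apply/esym; apply: contraNT xy => xy; rewrite eq_sym.
apply/eqP; apply: (connected_inv (P := fun t => t = x) _ cG) => // z t zt zx.
rewrite {}zx in zt; have := G_xy t; rewrite !inE => /orP[/eqP // | /eqP ty].
by rewrite -ty zt in xy.
Qed.

Theorem theorem4 (G : sgraph) (G_2conn : two_connected G)
  (G_neq_K2 : ~ isomorphic G (complete 2)) : prime_graph (Aux G).
Proof.
have cG := two_connected_connected G_2conn.
have [G_gt0 _] := andP cG.
have G_gt2 : 2 < #|G|.
  have [G_gt1 _] := andP G_2conn; rewrite ltn_neqAle G_gt1 andbT.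
  by apply/eqP=> /esym /(connected_card2 cG).
have cA := Aux_connected G_gt0 cG.
have [/card_gt0P[T _] _] := andP cA.
apply: (prime_of_connected_link cA (Aux_link_connected G_gt0 T G_gt2 _)) => v.
exact: two_connected_del.
Qed.
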